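(* Let $m,n\ge 1$ be integers and let $\mathbf{p}(\mathbf{s})=\sum_{|\mathbf{i}|=n}\mathbf{c}_{\mathbf{i}}B^n_{\mathbf{i}}(\mathbf{s})$ be a triangular Bézier surface of degree $n$ in $\mathbb{R}^3$. Write its coordinate functions, in barycentric coordinates with respect to a fixed non-degenerate tetrahedron $\Lambda\subset\mathbb{R}^3$, as $p_k(\mathbf{s})=\sum_{|\mathbf{i}|=n}c_{\mathbf{i},k}B^n_{\mathbf{i}}(\mathbf{s})$, $k=1,2,3,4$, and let $\mathbf{c}^{(k)}=(c_{\mathbf{i},k})_{|\mathbf{i}|=n}$ be the corresponding coefficient arrays. For every multi-index $\mathbf{i}=(i_1,i_2,i_3,i_4)$ of non-negative integers with $|\mathbf{i}|=m$, define the array $(d_{\mathbf{i},\mathbf{j}})_{|\mathbf{j}|=mn}$ by repeated multiplication of the coordinate functions in Bernstein form: $$(d_{\mathbf{i},\mathbf{j}})_{|\mathbf{j}|=mn}=\binom{m}{\mathbf{i}}\,(\mathbf{c}^{(1)})^{*i_1}*(\mathbf{c}^{(2)})^{*i_2}*(\mathbf{c}^{(3)})^{*i_3}*(\mathbf{c}^{(4)})^{*i_4},$$ where $*$ is the Bernstein product of coefficient arrays defined in the context. Then for all $\mathbf{i}$ with $|\mathbf{i}|=m$ and all $\mathbf{s}\in\Omega$, $$B^m_{\mathbf{i}}(\mathbf{p}(\mathbf{s}))=\sum_{|\mathbf{j}|=mn}d_{\mathbf{i},\mathbf{j}}B^{mn}_{\mathbf{j}}(\mathbf{s}).$$ Consequently,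 the matrix $\mathbf{D}$ with $\binom{mn+2}{2}$ rows indexed by $\mathbf{j}$ ($|\mathbf{j}|=mn$) and $\binom{m+3}{3}$ columns indexed by $\mathbf{i}$ ($|\mathbf{i}|=m$), whose entry in row $\mathbf{j}$ and column $\mathbf{i}$ is $d_{\mathbf{i},\mathbf{j}}$, is the matrix of approximate implicitization: for every coefficient vector $\mathbf{b}=(b_{\mathbf{i}})_{|\mathbf{i}|=m}$, with $q(\mathbf{u})=\sum_{|\mathbf{i}|=m}b_{\mathbf{i}}B^m_{\mathbf{i}}(\mathbf{u})$, $$q(\mathbf{p}(\mathbf{s}))=\mathbf{B}^{mn}(\mathbf{s})^T\mathbf{D}\mathbf{b}\qquad\text{for all }\mathbf{s}\in\Omega,$$ where $\mathbf{B}^{mn}(\mathbf{s})=(B^{mn}_{\mathbf{j}}(\mathbf{s}))_{|\mathbf{j}|=mn}$ is regarded as a column vector.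
   Context: Barycentric coordinates. A point $\mathbf{x}\in\mathbb{R}^l$ has barycentric coordinates $\bm{\beta}=(\beta_1,\dots,\beta_{l+1})$ with respect to a non-degenerate simplex with vertices $\mathbf{a}_1,\dots,\mathbf{a}_{l+1}$ if $\mathbf{x}=\sum_i\beta_i\mathbf{a}_i$ and $\sum_i\beta_i=1$. $\Omega$ is a non-degenerate triangle (points $\mathbf{s}\in\Omega$ are written in barycentric coordinates $\mathbf{s}=(s_1,s_2,s_3)$, $s_k\ge0$, $s_1+s_2+s_3=1$), and $\Lambda$ is a non-degenerate tetrahedron in $\mathbb{R}^3$ (points $\mathbf{u}$ of $\mathbb{R}^3$ are written in barycentric coordinates $\mathbf{u}=(u_1,u_2,u_3,u_4)$ with respect to $\Lambda$). Multi-indices and Bernstein polynomials. Multi-indices $\mathbf{i}=(i_1,\dots,i_{l+1})$ have non-negative integer entries (three entries for polynomials in $\mathbf{s}$, four for polynomials in $\mathbf{u}$); $|\mathbf{i}|=i_1+\cdots+i_{l+1}$, $\bm{\beta}^{\mathbf{i}}=\beta_1^{i_1}\cdots\beta_{l+1}^{i_{l+1}}$, and $\binom{n}{\mathbf{i}}=\frac{n!}{i_1!\cdots i_{l+1}!}$ for $|\mathbf{i}|=n$. The Bernstein polynomials of degree $n$ are $B^n_{\mathbf{i}}(\bm{\beta})=\binom{n}{\mathbf{i}}\bm{\beta}^{\mathbf{i}}$, $|\mathbf{i}|=n$. Multi-indices of a given length and degree are ordered lexicographically (any fixed ordering used consistently suffices). Bézier triangle. The control points $\mathbf{c}_{\mathbf{i}}$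 ($|\mathbf{i}|=n$, three-entry multi-indices) are points of $\mathbb{R}^3$, given by barycentric coordinates $\mathbf{c}_{\mathbf{i}}=(c_{\mathbf{i},1},c_{\mathbf{i},2},c_{\mathbf{i},3},c_{\mathbf{i},4})$ with respect to $\Lambda$, so that $\mathbf{p}(\mathbf{s})=(p_1(\mathbf{s}),\dots,p_4(\mathbf{s}))$ in barycentric coordinates and $B^m_{\mathbf{i}}(\mathbf{p}(\mathbf{s}))=\binom{m}{\mathbf{i}}p_1(\mathbf{s})^{i_1}p_2(\mathbf{s})^{i_2}p_3(\mathbf{s})^{i_3}p_4(\mathbf{s})^{i_4}$. Bernstein product of arrays. For arrays $\mathbf{a}=(a_{\mathbf{i}})_{|\mathbf{i}|=p}$ and $\mathbf{e}=(e_{\mathbf{j}})_{|\mathbf{j}|=r}$ indexed by three-entry multi-indices, $\mathbf{a}*\mathbf{e}$ is the array indexed by $|\mathbf{k}|=p+r$ with $$(\mathbf{a}*\mathbf{e})_{\mathbf{k}}=\sum_{\substack{|\mathbf{i}|=p,\ |\mathbf{j}|=r\\ \mathbf{i}+\mathbf{j}=\mathbf{k}}}\frac{\binom{p}{\mathbf{i}}\binom{r}{\mathbf{j}}}{\binom{p+r}{\mathbf{k}}}a_{\mathbf{i}}e_{\mathbf{j}}.$$ This corresponds to the product rule $B^p_{\mathbf{i}}B^r_{\mathbf{j}}=\frac{\binom{p}{\mathbf{i}}\binom{r}{\mathbf{j}}}{\binom{p+r}{\mathbf{i}+\mathbf{j}}}B^{p+r}_{\mathbf{i}+\mathbf{j}}$.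 $\mathbf{a}^{*t}$ denotes the $t$-fold $*$-power, with $\mathbf{a}^{*0}$ the degree-$0$ array with single entry $1$. *)

(* Defs.v *)
From HB Require Import structures.
From mathcomp Require Import all_boot all_order all_algebra.
From mathcomp Require Import classical_sets reals.

Set Implicit Arguments.
Unset Strict Implicit.
Unset Printing Implicit Defensive.

Import Order.TTheory GRing.Theory Num.Theory.
Local Open Scope ring_scope.

(* The bound i_k <= n on the entries is implied by |i| = n; imposing it makes *)
(* the type finite, and [enum_val] supplies a fixed ordering.                 *)
Definition mindex (l n : nat) : predArgType :=
  {i : {ffun 'I_l -> 'I_n.+1} | (\sum_k i k)%N == n}.

HB.instance Definition _ l n := Finite.on (mindex l n).

Definition mindex_entry l n (i : mindex l n) (k : 'I_l) : nat := sval i k.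
Coercion mindex_entry : mindex >-> Funclass.

Section Barycentric.
Variables (R : realType) (l : nat).

(* The rows of [a] are the l + 1 vertices of a simplex in R^l. *)
Implicit Types (a : 'M[R]_(l.+1, l)) (x : 'rV[R]_l) (beta : 'rV[R]_l.+1).

Definition edges a : 'M[R]_l :=
  \matrix_(i < l) (row (lift ord0 i) a - row ord0 a).

Definition nondegenerate_simplex a : Prop := row_free (edges a).

Definition is_bary a x beta : Prop :=
  x = \sum_i beta 0 i *: row i a /\ \sum_i beta 0 i = 1.

Definition bary a x : 'rV[R]_l.+1 := xget 0 [set beta | is_bary a x beta]%classic.

Lemma is_bary_edges a x beta : is_bary a x beta ->
  x - row ord0 a = (\row_(i < l) beta 0 (lift ord0 i)) *m edges a.
Proof.
move=> [-> s1]; rewrite mulmx_sum_row.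
under [RHS]eq_bigr => i _ do rewrite mxE rowK scalerBr.
rewrite sumrB -scaler_suml big_ord_recl.
have -> : beta 0 ord0 = 1 - \sum_(i < l) beta 0 (lift ord0 i).
  by rewrite -s1 big_ord_recl addrK.
apply/eqP; rewrite subr_eq scalerBl scale1r; apply/eqP.
by rewrite [RHS]addrC [X in _ = _ + X]addrC addrA.
Qed.

Lemma is_bary_uniq a x beta beta' : nondegenerate_simplex a ->
  is_bary a x beta -> is_bary a x beta' -> beta = beta'.
Proof.
move=> nd b1 b2.
have /(row_free_inj nd) e :
    (\row_(i < l) beta 0 (lift ord0 i)) *m edges a =
    (\row_(i < l) beta' 0 (lift ord0 i)) *m edges a.
  by rewrite -(is_bary_edges b1) -(is_bary_edges b2).
have e' i : beta 0 (lift ord0 i) = beta' 0 (lift ord0 i).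
  by move/rowP/(_ i): e; rewrite !mxE.
apply/rowP => i; case: (unliftP ord0 i) => [j ->|->]; first exact: e'.
case: b1 b2 => _ s1 [_ s2]; move: s1; rewrite -s2 !big_ord_recl.
by under eq_bigr => j _ do rewrite e'; move/addIr.
Qed.

Lemma baryP a x : nondegenerate_simplex a -> is_bary a x (bary a x).
Proof.
move=> nd; pose g := (x - row ord0 a) *m invmx (edges a).
pose beta : 'rV[R]_l.+1 := \row_i
  (if unlift ord0 i is Some j then g 0 j else 1 - \sum_j g 0 j).
have b0 : beta 0 ord0 = 1 - \sum_j g 0 j by rewrite mxE unlift_none.
have bS j : beta 0 (lift ord0 j) = g 0 j by rewrite mxE liftK.
suff h : is_bary a x beta.
  by apply: (@xgetPex _ 0 [set b | is_bary a x b]%classic); exists beta.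
have sE : \sum_(j < l) beta 0 (lift ord0 j) = \sum_j g 0 j.
  by apply: eq_bigr => j _; rewrite bS.
split; last by rewrite big_ord_recl b0 sE subrK.
have : g *m edges a = x - row ord0 a.
  by rewrite mulmxKV // -row_free_unit.
rewrite mulmx_sum_row.
under eq_bigr => i _ do rewrite rowK scalerBr.
rewrite sumrB -scaler_suml => /eqP; rewrite eq_sym subr_eq => /eqP ->.
rewrite big_ord_recl b0 scalerBl scale1r addrAC -addrA addrC.
by congr (_ + _); apply: eq_bigr => i _; rewrite bS.
Qed.

Definition in_simplex a x : Prop := forall k, 0 <= bary a x 0 k.

End Barycentric.

Section Bernstein.
Variable R : realType.

Definition multinom l n (i : mindex l n) : R :=
  n`!%:R / \prod_k (i k)`!%:R.

Definition bernstein l n (i : mindex l n) (beta : 'rV[R]_l) : R :=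
  multinom i * \prod_k beta 0 k ^+ i k.

Definition barray (p : nat) := mindex 3 p -> R.

Definition bmul p r (a : barray p) (e : barray r) : barray (p + r) :=
  fun k => \sum_(i : mindex 3 p)
    \sum_(j : mindex 3 r | [forall t, (i t + j t)%N == k t])
      multinom i * multinom j / multinom k * a i * e j.

Fixpoint bpow p (a : barray p) (t : nat) : barray (t * p) :=
  match t return barray (t * p) with
  | 0%N => fun _ => 1
  | t'.+1 => bmul a (@bpow p a t')
  end.

Arguments bpow {p} a t.

Definition i1 : 'I_4 := @Ordinal 4 0 isT.
Definition i2 : 'I_4 := @Ordinal 4 1 isT.
Definition i3 : 'I_4 := @Ordinal 4 2 isT.
Definition i4 : 'I_4 := @Ordinal 4 3 isT.

Lemma mindex4_degree m n (i : mindex 4 m) :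
  (m * n = i i1 * n + i i2 * n + i i3 * n + i i4 * n)%N.
Proof.
have /eqP e := valP i; rewrite -[in LHS]e !big_ord_recl big_ord0 addn0.
rewrite -!mulnDl !addnA; congr (_ * n)%N.
by congr (_ + _ + _ + _)%N; rewrite /mindex_entry; congr (nat_of_ord (sval i _));
  apply: val_inj.
Qed.

(* The cast only transports the degree m n to i_1 n + i_2 n + i_3 n + i_4 n. *)
Definition dcoef m n (c : 'I_4 -> barray n) (i : mindex 4 m) : barray (m * n) :=
  fun j => multinom i *
    bmul (bmul (bmul (bpow (c i1) (i i1)) (bpow (c i2) (i i2)))
               (bpow (c i3) (i i3)))
         (bpow (c i4) (i i4))
      (ecast d (mindex 3 d) (mindex4_degree n i) j).

Definition Dmatrix m n (c : 'I_4 -> barray n) :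
    'M[R]_(#|{: mindex 3 (m * n)}|, #|{: mindex 4 m}|) :=
  \matrix_(r, t) dcoef c (enum_val t : mindex 4 m) (enum_val r).

Definition colvec (T : finType) (f : T -> R) : 'cV[R]_#|T| :=
  \col_t f (enum_val t).

Definition bernstein_form l n (b : mindex l n -> R) (beta : 'rV[R]_l) : R :=
  \sum_i b i * bernstein i beta.

Definition bezier n (C : mindex 3 n -> 'rV[R]_3) (s : 'rV[R]_3) : 'rV[R]_3 :=
  \sum_i bernstein i s *: C i.

End Bernstein.

Arguments bpow {R p} a t.

(* Main.v *)
Require Import Defs.
From mathcomp Require Import all_boot all_order all_algebra.
From mathcomp Require Import classical_sets reals.
From mathcomp Require Import ring.

Set Implicit Arguments.
Unset Strict Implicit.
Unset Printing Implicit Defensive.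

Import Order.TTheory GRing.Theory Num.Theory.
Local Open Scope ring_scope.

(** Fix s and send an array of Bernstein coefficients to the value at s of the
polynomial that it represents ([bernstein_form]). The product of two Bernstein
polynomials is a multiple of a third one, and the weights in [bmul] are exactly
these multiples, so evaluation turns [bmul] into the product of reals
([bernstein_form_bmul]) and [bpow] into powers ([bernstein_form_bpow]).
Evaluating the array [dcoef c i] therefore gives the multinomial coefficient of
i times the product of the powers p_k(s)^(i_k), which is the Bernstein
polynomial of index i at the point (p_1(s), ..., p_4(s))
([bernstein_form_dcoef]).

It remains to see that the p_k(s) are the barycentric coordinates of p(s). The
weights B_i(s) of the control points sum to (s_1 + s_2 + s_3)^n = 1 by the
multinomial theorem ([multinomial_theorem]); hence p(s) is an affine combination
of the control points, and barycentric coordinates respect affine combinations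
([is_bary_affine], [bary_bezier]).

The matrix identity is the linear combination of the polynomial identities with
coefficients b_i ([colvec_Dmatrix]), and the size of the matrix comes from the
number of weak compositions ([card_mindex]). *)

(** * Multi-indices *)

Lemma mindex_sum l n (i : mindex l n) : (\sum_k i k = n)%N.
Proof. exact/eqP/(valP i). Qed.

Lemma mindex_inj l n (i j : mindex l n) : (forall k, i k = j k) -> i = j.
Proof. by move=> e; apply/val_inj/ffunP => k; apply/val_inj/e. Qed.

Lemma mindex_of_subproof l n (f : 'I_l -> nat) : (\sum_k f k = n)%N ->
  (\sum_k [ffun k => inord (f k) : 'I_n.+1] k)%N == n.
Proof.
move=> fn; rewrite -[X in _ == X]fn; apply/eqP/eq_bigr => k _.
by rewrite ffunE inordK // ltnS -fn (bigD1 k) //= leq_addr.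
Qed.

Definition mindex_of l n (f : 'I_l -> nat) (fn : (\sum_k f k = n)%N) :
  mindex l n :=
  exist (fun i : {ffun 'I_l -> 'I_n.+1} => (\sum_k i k)%N == n) _
    (mindex_of_subproof fn).

Lemma mindex_ofE l n (f : 'I_l -> nat) (fn : (\sum_k f k = n)%N) k :
  mindex_of fn k = f k.
Proof.
by rewrite /mindex_entry /= ffunE inordK // ltnS -fn (bigD1 k) //= leq_addr.
Qed.

(** Listing the entries identifies multi-indices with the tuples of
[card_ord_partitions]. *)
Lemma card_mindex l n : #|{: mindex l.+1 n}| = 'C(n + l, l).
Proof.
rewrite addnC -card_ord_partitions.
pose g (i : mindex l.+1 n) : l.+1.-tuple 'I_n.+1 := [tuple sval i k | k < l.+1].
have g_inj : injective g.
  move=> i j e; apply: mindex_inj => k; rewrite /mindex_entry.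
  by have := congr1 (fun t => tnth t k) e; rewrite !tnth_mktuple => ->.
rewrite -(card_imset predT g_inj); apply: eq_card => t; rewrite inE.
apply/imsetP/eqP => [[i _ ->]|tn].
  by rewrite big_tuple -[RHS](mindex_sum i); apply: eq_bigr => k _;
    rewrite tnth_mktuple.
have tn' : (\sum_k (tnth t k : nat) = n)%N by rewrite -[RHS]tn big_tuple.
exists (mindex_of tn') => //; apply/eq_from_tnth => k; apply/val_inj.
by rewrite tnth_mktuple; have := mindex_ofE tn' k.
Qed.

(** * Partition of unity *)

Section Bernstein.
Variable R : realType.

Lemma fact_prod_neq0 l n (i : mindex l n) : \prod_k (i k)`!%:R != 0 :> R.
Proof. by apply/prodf_neq0 => k _; rewrite pnatr_eq0 -lt0n fact_gt0. Qed.

Lemma multinom_neq0 l n (i : mindex l n) : multinom R i != 0.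
Proof.
by rewrite mulf_neq0 ?invr_neq0 ?fact_prod_neq0 // pnatr_eq0 -lt0n fact_gt0.
Qed.

Lemma raise_subproof l n (k : 'I_l) (i : mindex l n) :
  (\sum_t (i t + (t == k)) = n.+1)%N.
Proof.
rewrite big_split /= mindex_sum (bigD1 k) //= eqxx big1 ?addn0 ?addn1 //.
by move=> t /negPf ->.
Qed.

Definition raise l n (k : 'I_l) (i : mindex l n) : mindex l n.+1 :=
  mindex_of (raise_subproof k i).

Lemma raise_inj l n (k : 'I_l) : injective (@raise l n k).
Proof.
move=> i j e; apply: mindex_inj => t.
by have := congr1 (fun a : mindex l n.+1 => a t) e;
  rewrite !mindex_ofE => /addIn.
Qed.

(** With [raise_inj]: raising entry k is a bijection onto the multi-indices of
degree n + 1 whose entry k is positive. *)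
Lemma raise_surj l n (k : 'I_l) (j : mindex l n.+1) : (0 < j k)%N ->
  exists i : mindex l n, raise k i = j.
Proof.
move=> jk.
have jB t : (j t - (t == k) + (t == k) = j t)%N.
  by rewrite subnK //; case: eqP => [->|].
have dn : (\sum_t (j t - (t == k)) = n)%N.
  apply: succn_inj; rewrite -[RHS](mindex_sum j) -addn1.
  rewrite -[1%N](_ : \sum_t (t == k) = 1)%N; last first.
    by rewrite (bigD1 k) //= eqxx big1 ?addn0 // => t /negPf ->.
  by rewrite -big_split; apply: eq_bigr => t _; rewrite /= jB.
by exists (mindex_of dn); apply: mindex_inj => t; rewrite !mindex_ofE jB.
Qed.

(** Raising entry k multiplies the monomial by x_k and the multinomial
coefficient by (n + 1) / (i_k + 1). *)
Lemma bernstein_raise l n (k : 'I_l) (i : mindex l n) (x : 'rV[R]_l) :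
  n.+1%:R * (x 0 k * bernstein i x) =
  (raise k i k)%:R * bernstein (raise k i) x.
Proof.
have fE : \prod_t (raise k i t)`!%:R
    = (i k).+1%:R * \prod_t (i t)`!%:R :> R.
  rewrite (bigD1 k) //= [in RHS](bigD1 k) //= mindex_ofE eqxx addn1 factS natrM.
  rewrite -mulrA; congr (_ * (_ * _)); apply: eq_bigr => t /negPf tk.
  by rewrite mindex_ofE tk addn0.
have xE : \prod_t x 0 t ^+ raise k i t = x 0 k * \prod_t x 0 t ^+ i t.
  rewrite (bigD1 k) //= [in RHS](bigD1 k) //= mindex_ofE eqxx addn1 exprS.
  rewrite -mulrA; congr (_ * (_ * _)); apply: eq_bigr => t /negPf tk.
  by rewrite mindex_ofE tk addn0.
rewrite /bernstein /multinom fE xE mindex_ofE eqxx addn1 factS natrM.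
have ik : (i k).+1%:R != 0 :> R by rewrite pnatr_eq0.
have P0 := fact_prod_neq0 i.
move: ((i k).+1%:R) (\prod_t (i t)`!%:R) ik P0 => K P K0 P0.
by field; rewrite K0 P0.
Qed.

Lemma mindex0 l (i : mindex l 0) k : i k = 0%N.
Proof.
by apply/eqP; rewrite -leqn0 -[leqRHS](mindex_sum i) (bigD1 k) //= leq_addr.
Qed.

Lemma bernstein_degree0 l (i : mindex l 0) (x : 'rV[R]_l) : bernstein i x = 1.
Proof.
by rewrite /bernstein /multinom !big1 ?divr1 ?mulr1 // => k _; rewrite mindex0.
Qed.

Lemma sum_bernstein_degree0 l (x : 'rV[R]_l) :
  \sum_(i : mindex l 0) bernstein i x = 1.
Proof.
have z : (\sum_(k < l) 0 = 0 :> nat)%N by rewrite big1.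
rewrite (big_pred1 (mindex_of z)) ?bernstein_degree0 // => i.
by apply/esym/eqP/mindex_inj => k; rewrite !mindex0.
Qed.

(** By induction on n: in (sum of the x_k) * (sum of the B_i of degree n), the
terms x_k B_i are grouped by j = raise k i. By [bernstein_raise] such a term is
the fraction j_k / (n + 1) of B_j, and for fixed j these fractions sum to 1. *)
Lemma multinomial_theorem l n (x : 'rV[R]_l) :
  \sum_(i : mindex l n) bernstein i x = (\sum_k x 0 k) ^+ n.
Proof.
elim: n => [|n IHn]; first by rewrite sum_bernstein_degree0.
rewrite exprS -IHn mulr_suml.
under [RHS]eq_bigr => k _ do rewrite mulr_sumr
  (partition_big (raise k) predT) //=.
rewrite exchange_big; apply: eq_bigr => /= j _.
have n1 : n.+1%:R != 0 :> R by rewrite pnatr_eq0.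
(* n + 1, multiplied in, is split as the sum of the entries j_k. *)
apply: (mulfI n1); rewrite mulr_sumr -[X in X%:R * _](mindex_sum j).
rewrite natr_sum mulr_suml.
(* If j_k = 0, no i is raised to j at k; otherwise exactly one is. *)
apply: eq_bigr => k _; have [jk|jk] := posnP (j k).
  rewrite jk mul0r big_pred0 ?mulr0 // => i; apply/eqP => e.
  have := mindex_ofE (raise_subproof k i) k.
  by rewrite -/(raise k i) e jk eqxx addn1.
have [i ij] := raise_surj jk.
rewrite (big_pred1 i) => [|i']; first by rewrite bernstein_raise ij.
by rewrite -ij (inj_eq (@raise_inj _ _ k)).
Qed.

(** * Products in Bernstein form *)

Lemma mindex_add_subproof l p r (i : mindex l p) (j : mindex l r) :
  (\sum_t (i t + j t) = p + r)%N.
Proof. by rewrite big_split /= !mindex_sum. Qed.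

Definition mindex_add l p r (i : mindex l p) (j : mindex l r) :
  mindex l (p + r) := mindex_of (mindex_add_subproof i j).

Lemma bernsteinM l p r (i : mindex l p) (j : mindex l r) (x : 'rV[R]_l) :
  bernstein i x * bernstein j x =
  multinom R i * multinom R j / multinom R (mindex_add i j)
    * bernstein (mindex_add i j) x.
Proof.
rewrite /bernstein [in RHS]mulrA divfK ?multinom_neq0 // mulrACA.
congr (_ * _); rewrite -big_split; apply: eq_bigr => t _ /=.
by rewrite mindex_ofE exprD.
Qed.

(** A pair (i, j) contributes to the single entry k = i + j, so after the sum
over k is moved inside, [bernsteinM] applies to each pair separately. *)
Lemma bernstein_form_bmul p r (a : barray R p) (e : barray R r)
    (x : 'rV[R]_3) :
  bernstein_form (bmul a e) x = bernstein_form a x * bernstein_form e x.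
Proof.
rewrite /bernstein_form /bmul mulr_suml.
under eq_bigr => k _ do rewrite mulr_suml.
rewrite exchange_big; apply: eq_bigr => i _ /=.
rewrite mulr_sumr.
under eq_bigr => k _ do rewrite big_mkcond mulr_suml.
rewrite exchange_big; apply: eq_bigr => j _ /=.
rewrite (bigD1 (mindex_add i j)) //= big1 ?addr0 => [|k kij].
  rewrite ifT; last by apply/forallP => t; rewrite mindex_ofE.
  by rewrite [RHS]mulrACA bernsteinM [RHS]mulrCA !mulrA.
rewrite ifF ?mul0r //; apply/negP => /forallP ijk; case/eqP: kij.
by apply: mindex_inj => t; rewrite mindex_ofE (eqP (ijk t)).
Qed.

Lemma bernstein_form_bpow p (a : barray R p) t (x : 'rV[R]_3) :
  bernstein_form (bpow a t) x = bernstein_form a x ^+ t.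
Proof.
elim: t => [|t IHt] /=; last by rewrite exprS -IHt -bernstein_form_bmul.
rewrite expr0 -[RHS](sum_bernstein_degree0 x); apply: eq_bigr => i _.
by rewrite mul1r.
Qed.

Lemma bernstein_form_ecast l p r (e : r = p) (b : mindex l p -> R)
    (x : 'rV[R]_l) :
  bernstein_form (fun j => b (ecast d (mindex l d) e j)) x
  = bernstein_form b x.
Proof. by case: p / e b. Qed.

(** Evaluation at x turns the Bernstein product of powers into the product of the
y_k ^+ i k; the multinomial factor in [dcoef] completes it to the Bernstein
polynomial of index i. *)
Lemma bernstein_form_dcoef m n (c : 'I_4 -> barray R n) (i : mindex 4 m)
    (x : 'rV[R]_3) (y : 'rV[R]_4) :
  (forall k, y 0 k = bernstein_form (c k) x) ->
  bernstein_form (dcoef c i) x = bernstein i y.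
Proof.
move=> yE; rewrite {1}/bernstein_form /dcoef.
under eq_bigr => j _ do rewrite -mulrA.
rewrite -mulr_sumr; congr (_ * _).
set b := bmul _ _; rewrite [LHS](bernstein_form_ecast (mindex4_degree n i) b).
rewrite !bernstein_form_bmul !bernstein_form_bpow -!yE.
rewrite !big_ord_recl big_ord0 mulr1 !mulrA.
by do !congr (_ * _); congr (y 0 _ ^+ i _); apply: val_inj.
Qed.

Lemma colvec_Dmatrix m n (c : 'I_4 -> barray R n) (b : mindex 4 m -> R)
    (f : mindex 3 (m * n) -> R) :
  ((colvec f)^T *m Dmatrix m c *m colvec b) 0 0 =
  \sum_i b i * \sum_j dcoef c i j * f j.
Proof.
rewrite mxE [in RHS]big_enum_val; apply: eq_bigr => t _.
rewrite !mxE mulrC; congr (_ * _); rewrite [in RHS]big_enum_val.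
by apply: eq_bigr => r _; rewrite !mxE mulrC.
Qed.

End Bernstein.

(** * Affine combinations *)

(** The coordinates of the combination sum to the sum of the weights, so the
hypothesis that the weights sum to 1 is what makes them barycentric. *)
Lemma is_bary_affine (R : realType) l (I : finType) (a : 'M[R]_(l.+1, l))
    (w : I -> R) (y : I -> 'rV[R]_l) (beta : I -> 'rV[R]_l.+1) :
  \sum_i w i = 1 -> (forall i, is_bary a (y i) (beta i)) ->
  is_bary a (\sum_i w i *: y i) (\sum_i w i *: beta i).
Proof.
move=> w1 yb; split.
  under [RHS]eq_bigr => k _ do rewrite summxE scaler_suml.
  rewrite exchange_big; apply: eq_bigr => i _ /=.
  rewrite {1}(yb i).1 scaler_sumr; apply: eq_bigr => k _.
  by rewrite mxE scalerA.
under eq_bigr => k _ do rewrite summxE.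
rewrite exchange_big -[RHS]w1; apply: eq_bigr => i _ /=.
under eq_bigr => k _ do rewrite mxE.
by rewrite -mulr_sumr (yb i).2 mulr1.
Qed.

(** A Bezier point is an affine combination of its control points, its weights
summing to 1 by [multinomial_theorem]; uniqueness of barycentric coordinates
then identifies those of the point. *)
Lemma bary_bezier (R : realType) n (a : 'M[R]_(4, 3))
    (C : mindex 3 n -> 'rV[R]_3) (s : 'rV[R]_3) k :
  nondegenerate_simplex a -> \sum_t s 0 t = 1 ->
  bary a (bezier C s) 0 k = bernstein_form (fun i => bary a (C i) 0 k) s.
Proof.
move=> nd s1.
have B1 : \sum_(i : mindex 3 n) bernstein i s = 1.
  by rewrite multinomial_theorem s1 expr1n.
have h := is_bary_affine B1 (fun i => baryP (C i) nd).
rewrite (is_bary_uniq nd (baryP _ nd) h) summxE; apply: eq_bigr => i _.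
by rewrite mxE mulrC.
Qed.

(** * Implicitization matrix *)

Theorem proposition1 (R : realType) (m n : nat) (m_ge1 : (1 <= m)%N)
    (n_ge1 : (1 <= n)%N)
    (Omega : 'M[R]_(3, 2)) (Omega_nd : nondegenerate_simplex Omega)
    (Lambda : 'M[R]_(4, 3)) (Lambda_nd : nondegenerate_simplex Lambda)
    (C : mindex 3 n -> 'rV[R]_3) :
  let p (x : 'rV[R]_2) : 'rV[R]_3 := bezier C (bary Omega x) in
  let c (k : 'I_4) : barray R n := fun i => bary Lambda (C i) 0 k in
  let d (i : mindex 4 m) : barray R (m * n) := dcoef c i in
  let D := Dmatrix m c in
  [/\ forall (x : 'rV[R]_2) (k : 'I_4), in_simplex Omega x ->
        bary Lambda (p x) 0 k =
          \sum_(i : mindex 3 n) c k i * bernstein i (bary Omega x),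
      forall (i : mindex 4 m) (x : 'rV[R]_2), in_simplex Omega x ->
        bernstein i (bary Lambda (p x)) =
          \sum_(j : mindex 3 (m * n)) d i j * bernstein j (bary Omega x),
      #|{: mindex 3 (m * n)}| = 'C(m * n + 2, 2),
      #|{: mindex 4 m}| = 'C(m + 3, 3) &
      forall (b : mindex 4 m -> R) (x : 'rV[R]_2), in_simplex Omega x ->
        bernstein_form b (bary Lambda (p x)) =
          ((colvec (fun j : mindex 3 (m * n) =>
              bernstein j (bary Omega x)))^T *m D *m colvec b) 0 0].
Proof.
move=> p c d D.
have pE x k : bary Lambda (p x) 0 k = bernstein_form (c k) (bary Omega x).
  exact: bary_bezier Lambda_nd (baryP x Omega_nd).2.
have BE (i : mindex 4 m) x :
    bernstein i (bary Lambda (p x)) = bernstein_form (d i) (bary Omega x).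
  by rewrite (bernstein_form_dcoef i (pE x)).
split=> [x k _|i x _|||b x _]; [exact: pE|exact: BE|exact: card_mindex..|].
by rewrite colvec_Dmatrix; apply: eq_bigr => i _; rewrite BE.
Qed.
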